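(* Let $X$ be a pseudocompact space that has a dense subspace which is a Lindelöf $\Sigma$-space. Then $X$ is $\mu^{\#}_{pc}$-pseudocompact; that is, $X$ is pseudocompact and every relatively pseudocompact subset of $C_p(X)$ has compact closure in $C_p(X)$.
   Context: All spaces are Tychonoff. $C_p(X)$ is the space of continuous real-valued functions on $X$ with the topology of pointwise convergence. A space is pseudocompact if every continuous real-valued function on it is bounded. A subset $Y$ of a space $T$ is relatively pseudocompact in $T$ if there is a pseudocompact subspace $P$ with $Y\subset P\subset T$. A space $T$ is $\mu_{pc}$-complete if every relatively pseudocompact subset of $T$ has compact closure in $T$. A space $X$ is $\mu^{\#}_{pc}$-complete if $C_p(X)$ is $\mu_{pc}$-complete. A $\mu^{\#}_{pc}$-pseudocompact space is a pseudocompact $\mu^{\#}_{pc}$-complete space. A Lindelöf $p$-space is a space homeomorphic to a closed subspace of the product of a compact space and a separable metrizable space; a Lindelöf $\Sigma$-space is a continuous image of a Lindelöf $p$-space. *)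

(* Defs.v *)
From HB Require Import structures.
From mathcomp Require Import all_boot all_order all_algebra.
From mathcomp Require Import all_classical all_reals all_analysis.

Set Implicit Arguments.
Unset Strict Implicit.
Unset Printing Implicit Defensive.

Import numFieldNormedType.Exports.

Local Open Scope classical_set_scope.
Local Open Scope ring_scope.

(* The reals are an arbitrary [R : realType].
   A subspace of [T] is the type [set_type A] of a set [A : set T], into which
   [A] coerces, with the topology induced by the inclusion. *)

(* The library's complete regularity does not include any separation of
   points; by [uniform_separatorP] it is separation of points from closed sets
   by continuous functions into [0, 1]. *)
Definition tychonoff_space (T : topologicalType) : Prop :=
  hausdorff_space T /\ completely_regular_space T.

Definition homeomorphic (T U : topologicalType) : Prop :=
  exists (f : T -> U) (g : U -> T),
    [/\ continuous f, continuous g, cancel f g & cancel g f].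

Definition separable_space (T : topologicalType) : Prop :=
  exists2 D : set T, countable D & dense D.

Definition metrizable_space (R : realType) (T : topologicalType) : Prop :=
  exists M : metricType R, homeomorphic T M.

Definition pseudocompact_space (R : realType) (T : topologicalType) : Prop :=
  forall f : T -> R, continuous f -> bounded_fun f.

Definition relatively_pseudocompact (R : realType) (T : topologicalType)
    (Y : set T) : Prop :=
  exists P : set T, Y `<=` P /\ pseudocompact_space R (set_type P).

Definition mu_pc_complete (R : realType) (T : topologicalType) : Prop :=
  forall Y : set T, relatively_pseudocompact R Y -> compact (closure Y).

(* The inclusion into [{ptws X -> R}] gives the topology of pointwise
   convergence; the library puts no canonical topology on [continuousType]. *)
Definition Cp (R : realType) (X : topologicalType) : Type :=
  continuousType X R.

HB.instance Definition _ (R : realType) (X : topologicalType) :=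
  Topological.copy (Cp R X)
    (initial_topology (fun f : continuousType X R => (f : {ptws X -> R}))).

Definition mu_sharp_pc_complete (R : realType) (X : topologicalType) : Prop :=
  mu_pc_complete R (Cp R X).

Definition mu_sharp_pc_pseudocompact (R : realType) (X : topologicalType) :
    Prop :=
  pseudocompact_space R X /\ mu_sharp_pc_complete R X.

Definition lindelof_p_space (R : realType) (T : topologicalType) : Prop :=
  exists (K M : topologicalType) (F : set (K * M)),
    [/\ tychonoff_space K /\ compact [set: K],
        separable_space M /\ metrizable_space R M,
        closed F
      & homeomorphic T (set_type F)].

(* Tychonoff has to be required here: unlike for [lindelof_p_space], it is not
   a consequence of the other clause. *)
Definition lindelof_sigma_space (R : realType) (T : topologicalType) : Prop :=
  tychonoff_space T /\
  exists L : topologicalType, lindelof_p_space R L /\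
    exists f : L -> T, continuous f /\ f @` [set: L] = [set: T].

(* Main.v *)
(* Let [P] be a pseudocompact subspace of [C_p(X)] and [h] a pointwise limit of
   [P]; as [P] is pointwise bounded, it is enough that [h] is continuous.  The
   evaluation on [P * X] is separately continuous with both factors
   pseudocompact, so a sequence in either factor can be replaced by a point of
   that factor as far as countably many evaluations are concerned.  The dense
   Lindelof Sigma subspace serves to show that every nonempty basic open subset
   of [P] contains one of small diameter for the supremum norm over [X].  Given
   such thin sets, Grothendieck's double limit argument applies to them instead
   of to single functions, because a sequence of open subsets of [P], unlike a
   sequence of points, accumulates somewhere in [P]. *)
Require Import Defs.
From mathcomp Require Import all_boot all_order all_algebra.
From mathcomp Require Import all_classical all_reals all_analysis.
From mathcomp Require Import lra.

Set Implicit Arguments.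
Unset Strict Implicit.
Unset Printing Implicit Defensive.

Import Order.TTheory GRing.Theory Num.Theory.
Import numFieldNormedType.Exports.

Local Open Scope classical_set_scope.
Local Open Scope ring_scope.

(** * Pseudocompactness and limits along ultrafilters *)

Lemma pseudocompact_bound (R : realType) (T : topologicalType) (f : T -> R) :
  pseudocompact_space R T -> continuous f ->
  exists M : R, forall t, `|f t| <= M.
Proof.
move=> pcT /pcT bf; have [M fM] := @filter_ex _ (pinfty_nbhs R) _ _ bf.
by exists M => t; exact: fM.
Qed.

Lemma ultrafilter_map (S T : Type) (U : set_system S) (f : S -> T) :
  UltraFilter U -> UltraFilter (f x @[x --> U]).
Proof.
move=> UU; split; first exact: fmap_proper_filter.
move=> G GF fUG; rewrite predeqE => A; split; last exact: fUG.
move=> GA; have [//|UnA] := in_ultra_setVsetC (f @^-1` A) UU.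
have GnA : G (~` A) by exact: fUG.
by have /filter_ex [? []] : G (A `&` ~` A) by exact: filterI.
Qed.

Lemma bounded_ultra_cvg (R : realType) (S : Type) (U : set_system S)
    (f : S -> R) (M : R) :
  UltraFilter U -> U [set x | `|f x| <= M] ->
  exists c : R, f x @[x --> U] --> c.
Proof.
move=> UU fM; have fU := ultrafilter_map f UU.
have := @segment_compact R (- M) M; rewrite compact_ultra => /(_ _ fU).
case; last by move=> c [_ ?]; exists c.
apply: (@filterS _ U _ _ _ _ fM) => x /=.
by rewrite in_itv /= -ler_norml.
Qed.

Lemma continuous_sum_seq (R : realType) (T : topologicalType) (I : Type)
    (s : seq I) (f : I -> T -> R) :
  (forall i, continuous (f i)) -> continuous (fun t => \sum_(i <- s) f i t).
Proof.
move=> fc t; rewrite /continuous_at.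
apply: (@cvg_big _ _ +%R) => [|i _]; last exact: fc.
exact: add_continuous.
Qed.

(* Otherwise the bumps [u n t + `|u n t|] form a locally finite family, and a
   sum of multiples of them is continuous and unbounded. *)
Lemma pseudocompact_accumulation (R : realType) (T : topologicalType)
    (u : nat -> T -> R) (t : nat -> T) :
  pseudocompact_space R T ->
  (forall n, continuous (u n)) -> (forall n, 0 < u n (t n)) ->
  exists t0 : T, forall V, nbhs t0 V -> forall N, exists n,
    (N <= n)%N /\ exists2 s, V s & 0 < u n s.
Proof.
move=> pcT uc ut; apply: contrapT => noacc.
have lf (x : T) : exists N : nat,
    \forall s \near x, forall n : nat, (N <= n)%N -> u n s <= 0.
  apply: contrapT => xN; apply: noacc; exists x => V xV N.
  apply: contrapT => nV; apply: xN; exists N; apply: filterS xV => s Vs n Nn.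
  rewrite leNgt; apply/negP => us; apply: nV; exists n; split => //.
  by exists s.
(* Twice the positive part of [u n], rescaled so that its value at [t n] is [2 * n]. *)
pose b n s := n%:R / u n (t n) * (u n s + `|u n s|).
have b_ge0 n s : 0 <= b n s.
  rewrite /b mulr_ge0 ?divr_ge0 ?(ltW (ut n)) //.
  by rewrite -lerBlDl sub0r -normrN ler_norm.
have b_cont n : continuous (b n).
  move=> s; apply: cvgM; first exact: cvg_cst.
  by apply: cvgD; [exact: uc|apply: cvg_norm; exact: uc].
have b0 n s : u n s <= 0 -> b n s = 0.
  by move=> us; rewrite /b ler0_norm // subrr mulr0.
have [N HN] := choice lf.
have bN s n : (N s <= n)%N -> b n s = 0.
  by move=> Nn; apply: b0; apply: (nbhs_singleton (HN s)).
pose f s := \sum_(n < N s) b n s.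
(* Any cutoff past the nonzero terms gives the same sum, so one cutoff serves a whole
   neighbourhood. *)
have fE s m : (forall n, (m <= n)%N -> b n s = 0) -> f s = \sum_(n < m) b n s.
  move=> bm; have ext k l : (forall n, (k <= n)%N -> b n s = 0) -> (k <= l)%N ->
      \sum_(n < l) b n s = \sum_(n < k) b n s.
    move=> bk kl; rewrite -!(big_mkord xpredT (fun n => b n s)).
    rewrite (big_cat_nat (leq0n k) kl) /= [X in _ + X]big_nat_cond.
    rewrite [X in _ + X]big1 ?addr0 // => i.
    by rewrite andbT => /andP[ki _]; exact: bk.
  rewrite /f; have [|/ltnW] := leqP (N s) m => [le|le].
    by rewrite (ext _ _ _ le) // => n; exact: bN.
  by rewrite (ext _ _ bm le).
have fcont : continuous f.
  move=> s.
  have fs : {near nbhs s, (fun x => \sum_(n < N s) b n x) =1 f}.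
    apply: filterS (HN s) => x ux /=.
    by rewrite (@fE x (N s)) // => n Nn; apply: b0; exact: ux.
  rewrite /continuous_at (@fE s (N s)); last by move=> n; exact: bN.
  apply: cvg_trans (near_eq_cvg fs) _.
  by apply: (@continuous_sum_seq _ _ _ _ (fun n : 'I_(N s) => b n)) => i.
have [M fM] := pseudocompact_bound pcT fcont.
have := truncnS_gt M; set n := (_ _).+1 => Mn.
have bn : b n (t n) = n%:R *+ 2.
  by rewrite /b ger0_norm ?ltW // -mulr2n mulrnAr divfK // gt_eqF.
have nN : (n < N (t n))%N.
  rewrite ltnNge; apply/negP => /bN; rewrite bn => /eqP.
  by rewrite mulrn_eq0 pnatr_eq0.
have : n%:R <= f (t n).
  rewrite /f (bigD1 (Ordinal nN)) //= bn mulr2n -addrA lerDl.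
  by rewrite addr_ge0 // sumr_ge0 // => k _; exact: b_ge0.
by move=> /(lt_le_trans Mn) /lt_le_trans /(_ (ler_norm _)); rewrite ltNge fM.
Qed.

(** By boundedness all limits [c y] exist. The open sets where finite sums of [|Phi s y - c y|] are
    below [1 / (n + 1)] are nonempty, and at a point where they accumulate the evaluations take the
    values [c y]. So [t0] replaces a limit of [t] for countably many evaluations. *)
Lemma pseudocompact_ultralimit (R : realType) (T : topologicalType)
    (Y : eqType) (Phi : T -> Y -> R) (U : set_system nat) (t : nat -> T)
    (F : nat -> seq Y) :
  pseudocompact_space R T -> (forall y, continuous (Phi^~ y)) ->
  UltraFilter U ->
  exists t0, forall n, {in F n, forall y, Phi (t k) y @[k --> U] --> Phi t0 y}.
Proof.
move=> pcT Phic UU.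
have lim_t y : exists c : R, Phi (t k) y @[k --> U] --> c.
  have [M PhiM] := pseudocompact_bound pcT (Phic y).
  apply: (@bounded_ultra_cvg _ _ _ _ M) => //.
  by apply: nearW => k; exact: PhiM.
have [c Hc] := choice lim_t.
pose G n := flatten [seq F i | i <- iota 0 n.+1].
pose S n s := \sum_(y <- G n) `|Phi s y - c y|.
have S_cont n : continuous (S n).
  apply: (@continuous_sum_seq _ _ _ _ (fun y s => `|Phi s y - c y|)) => y s.
  by apply: cvg_norm; apply: cvgB; [exact: Phic|exact: cvg_cst].
have St n : exists s, 0 < n.+1%:R^-1 - S n s.
  have : S n (t k) @[k --> U] --> \sum_(y <- G n) `|c y - c y|.
    apply: (@cvg_big _ _ +%R) => [|y _]; first exact: add_continuous.
    by apply: cvg_norm; apply: cvgB; [exact: Hc|exact: cvg_cst].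
  rewrite big1; last by move=> y _; rewrite subrr normr0.
  have n0 : 0 < n.+1%:R^-1 :> R by rewrite invr_gt0 ltr0n.
  move=> /cvgr_dist_lt /(_ _ n0) /filter_ex[k].
  rewrite sub0r normrN => Sk; exists (t k); rewrite subr_gt0.
  exact: le_lt_trans (ler_norm _) Sk.
have [s Hs] := choice St.
have u_cont n : continuous (fun x => n.+1%:R^-1 - S n x).
  by move=> x; apply: cvgB; [exact: cvg_cst|exact: S_cont].
have [t0 Ht0] := pseudocompact_accumulation pcT u_cont Hs.
exists t0 => i y Fy; suff -> : Phi t0 y = c y by exact: Hc.
apply/eqP; rewrite -subr_eq0 -normr_eq0; apply/negPn/negP => e_neq0.
set e := `|_| in e_neq0; have e_gt0 : 0 < e / 2.
  by rewrite divr_gt0 // lt_neqAle eq_sym e_neq0 normr_ge0.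
(* From index [i] on, [y] occurs in the sum; the other bound makes [1 / (n + 1)] at most [e / 2]. *)
have := Phic y t0; move=> /cvgr_dist_lt /(_ _ e_gt0) near_t0.
have [n [Nn [x /= Vx]]] :=
  Ht0 _ near_t0 (maxn i (Num.truncn (e / 2)^-1)).
rewrite subr_gt0; apply/negP; rewrite -leNgt.
move: Nn; rewrite geq_max => /andP[le_in]; rewrite truncn_le_nat => en.
have Gy : y \in G n.
  apply/flattenP; exists (F i) => //; apply: map_f.
  by rewrite mem_iota /= add0n ltnS.
have : `|Phi x y - c y| <= S n x.
  by rewrite /S (big_rem _ Gy) /= lerDl sumr_ge0.
apply: le_trans.
have : n.+1%:R^-1 <= e / 2 by rewrite invf_ple ?posrE ?ltr0n // ltW.
move=> /le_trans; apply.
have : e <= `|Phi t0 y - Phi x y| + `|Phi x y - c y|.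
  by rewrite /e; apply: le_trans (ler_normD _ _); rewrite addrA subrK.
have {}Vx : `|Phi t0 y - Phi x y| < e / 2 := Vx.
by clearbody e; move: Vx; lra.
Qed.

(** * Balls given by finitely many evaluations *)

(** Induction on [G]: the bounded range of [g] is cut into finitely many bins of width [d], and nets
    for the remaining functions are taken inside each bin. *)
Lemma finite_net (R : realType) (T X : eqType) (Phi : T -> X -> R) (G : seq T)
    (N : set X) (d : R) :
  (forall t, exists M : R, forall x, `|Phi t x| <= M) -> 0 < d ->
  exists Q : seq X, {in Q, forall y, N y} /\
    forall x, N x -> exists2 y, y \in Q &
      {in G, forall g, `|Phi g x - Phi g y| < d}.
Proof.
move=> PhiM d_gt0; elim: G N => [|g G IH] N.
  have [[x0 Nx0]|N0] := pselect (exists x, N x).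
    exists [:: x0]; split=> [y|x Nx]; first by rewrite inE => /eqP->.
    by exists x0; rewrite ?mem_head.
  by exists [::]; split=> // x Nx; case: N0; exists x.
have [M gM] := PhiM g.
pose bin x := Num.truncn ((Phi g x + M) / d).
have bin_itv x : (bin x)%:R <= (Phi g x + M) / d < (bin x).+1%:R.
  apply: truncn_itv; rewrite divr_ge0 ?(ltW d_gt0) // -lerBlDr sub0r.
  by have := gM x; rewrite ler_norml => /andP[].
have [Q HQ] := choice (fun k => IH (N `&` [set x | bin x = k])).
pose K := Num.truncn ((M + M) / d).
exists (flatten [seq Q k | k <- iota 0 K.+1]); split=> [y|x Nx].
  by move=> /flattenP[_ /mapP[k _ ->]] /(HQ k).1[].
have [y Qy yG] := (HQ (bin x)).2 x (conj Nx erefl).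
exists y.
  apply/flattenP; exists (Q (bin x)) => //; apply: map_f.
  rewrite mem_iota add0n /= ltnS truncn_le_nat.
  apply: lt_le_trans (truncnS_gt _) _; rewrite ler_nat ltnS.
  apply: le_truncn; rewrite ler_pM2r ?invr_gt0 // lerD2r.
  exact: le_trans (ler_norm _) (gM x).
move=> h; rewrite inE => /orP[/eqP->|]; last exact: yG.
have [_ /= yx] := (HQ (bin x)).1 y Qy.
have := bin_itv y; have := bin_itv x; rewrite yx.
rewrite !ler_pdivlMr // !ltr_pdivrMr // mulrSr !mulrDl !mul1r.
rewrite ltr_norml; move: (_ * d) => a; lra.
Qed.

(** The common slack serves to fit a ball with non-strict bounds inside one with strict bounds. *)
Lemma seq_gap (R : realType) (X : eqType) (s : seq X) (f : X -> R) (r : R) :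
  {in s, forall a, f a < r} ->
  exists2 d, 0 < d & {in s, forall a, f a + d <= r}.
Proof.
elim: s => [|a s IH] fr; first by exists 1.
have [b bs|d d_gt0 Hd] := IH; first by apply: fr; rewrite inE bs orbT.
exists (Num.min d (r - f a)).
  by rewrite lt_min d_gt0 subr_gt0 fr // mem_head.
move=> b; rewrite inE -lerBrDl ge_min => /orP[/eqP->|/Hd].
  by rewrite lexx orbT.
by rewrite -lerBrDl => ->.
Qed.

(** The triple consists of centre, finite list of points and radius. The inequality is not strict,
    so that it passes to limits. *)
Definition pball (R : realType) (T X : eqType) (Phi : T -> X -> R)
    (b : T * seq X * R) : set T :=
  [set t | {in b.1.2, forall x, `|Phi t x - Phi b.1.1 x| <= b.2}].

(** Let the ball also control a finite net [Q] of [N], with radius at most [e / 6]. If two of its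
    members differ by more than [e] at [x], they differ by at most [e / 3] at the net point [y] of
    [x], so one of them separates [x] from [y] by more than [e / 3]. A small ball around that one
    keeps the separation. *)
Lemma pball_step (R : realType) (T X : eqType) (Phi : T -> X -> R)
    (b : T * seq X * R) (G : seq T) (N : set X) (e d : R) :
  (forall t, exists M : R, forall x, `|Phi t x| <= M) ->
  0 < b.2 -> 0 < e -> 0 < d ->
  exists b' : T * seq X * R,
    [/\ 0 < b'.2, pball Phi b' `<=` pball Phi b &
      (forall t t', pball Phi b' t -> pball Phi b' t' ->
         forall x, N x -> `|Phi t x - Phi t' x| <= e) \/
      exists x y, [/\ N x /\ N y, x \in b'.1.2 /\ y \in b'.1.2,
        {in G, forall g, `|Phi g x - Phi g y| < d} &
        forall t, pball Phi b' t -> e / 3 <= `|Phi t x - Phi t y|]].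
Proof.
case: b => -[g F] r PhiM /= r_gt0 e_gt0 d_gt0.
have [Q [QN Qnet]] := finite_net G N PhiM d_gt0.
pose r1 := Num.min r (e / 6); have r1_gt0 : 0 < r1.
  by rewrite lt_min r_gt0 divr_gt0.
have r1r : r1 <= r by rewrite ge_min lexx.
have r1e : r1 <= e / 6 by rewrite ge_min lexx orbT.
clearbody r1.
have FQ a : a \in F -> a \in F ++ Q by rewrite mem_cat => ->.
have QF a : a \in Q -> a \in F ++ Q by rewrite mem_cat orbC => ->.
pose B1 t := {in F ++ Q, forall a, `|Phi t a - Phi g a| < r1}.
have [[t [t' [x [Bt Bt' Nx tt'x]]]]|thin] := pselect (exists t t' x,
    [/\ B1 t, B1 t', N x & e < `|Phi t x - Phi t' x|]); last first.
  exists (g, F ++ Q, r1 / 2); split=> //=; first by rewrite divr_gt0.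
    by move=> t Bt a Fa /=; apply: le_trans (Bt a (FQ a Fa)) _ => /=; lra.
  left=> t t' Bt Bt' x Nx; rewrite leNgt; apply/negP => tt'x; apply: thin.
  exists t, t', x; split=> // a Qa.
    by apply: le_lt_trans (Bt a Qa) _ => /=; lra.
  by apply: le_lt_trans (Bt' a Qa) _ => /=; lra.
have [y Qy yG] := Qnet x Nx.
have key s : B1 s -> e / 3 < `|Phi s x - Phi s y| -> exists b' : T * seq X * R,
    [/\ 0 < b'.2, pball Phi b' `<=` pball Phi (g, F, r) &
      exists x y, [/\ N x /\ N y, x \in b'.1.2 /\ y \in b'.1.2,
        {in G, forall g, `|Phi g x - Phi g y| < d} &
        forall t, pball Phi b' t -> e / 3 <= `|Phi t x - Phi t y|]].
  move=> Bs sxy; have [r2 r2_gt0 Hr2] := seq_gap Bs.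
  (* [r2] keeps the new ball inside the old one; the other bound lets the values at [x] and [y] both
     move by [r']. *)
  pose r' := Num.min r2 ((`|Phi s x - Phi s y| - e / 3) / 2).
  have r'r2 : r' <= r2 by rewrite ge_min lexx.
  have r'xy : r' <= (`|Phi s x - Phi s y| - e / 3) / 2.
    by rewrite ge_min lexx orbT.
  exists (s, x :: F ++ Q, r'); split=> /=.
  - by rewrite lt_min r2_gt0 divr_gt0 // subr_gt0.
  - move=> u Bu a Fa /=.
    have /Bu /= us : a \in x :: F ++ Q by rewrite inE FQ ?orbT.
    have sg := Hr2 _ (FQ _ Fa).
    by have := ler_distD (Phi s a) (Phi u a) (Phi g a); lra.
  exists x, y; split=> //; first by split=> //; exact: QN.
    by rewrite mem_head inE QF ?orbT.
  move=> u Bu; have /= ux := Bu x (mem_head _ _).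
  have /Bu /= uy : y \in x :: F ++ Q by rewrite inE QF ?orbT.
  have := ler_distD (Phi u x) (Phi s x) (Phi s y).
  have := ler_distD (Phi u y) (Phi u x) (Phi s y).
  rewrite (distrC (Phi s x) (Phi u x)); lra.
have [sxy|] := ltrP (e / 3) `|Phi t x - Phi t y|.
  by have [b' [? ? ?]] := key t Bt sxy; exists b'; split=> //; right.
have [sxy _|] := ltrP (e / 3) `|Phi t' x - Phi t' y|.
  by have [b' [? ? ?]] := key t' Bt' sxy; exists b'; split=> //; right.
have := Bt y (QF y Qy); have := Bt' y (QF y Qy).
have := ler_distD (Phi t y) (Phi t x) (Phi t' x).
have := ler_distD (Phi t' y) (Phi t y) (Phi t' x).
have := ler_distD (Phi g y) (Phi t y) (Phi t' y).
rewrite (distrC (Phi t' y) (Phi t' x)) (distrC (Phi g y) (Phi t' y)); lra.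
Qed.

(** * Small sets for the supremum norm *)

Lemma lim_dist_le (R : realType) (U : set_system nat) (u v : nat -> R)
    (l m r : R) : ProperFilter U ->
  u k @[k --> U] --> l -> v k @[k --> U] --> m ->
  (\forall k \near U, `|u k - v k| <= r) -> `|l - m| <= r.
Proof.
move=> UU ul vm uvr.
apply: (closed_cvg (fun x => x <= r) (@closed_le R r) uvr).
by apply: cvg_norm; exact: cvgB.
Qed.

Lemma lim_dist_ge (R : realType) (U : set_system nat) (u v : nat -> R)
    (l m r : R) : ProperFilter U ->
  u k @[k --> U] --> l -> v k @[k --> U] --> m ->
  (\forall k \near U, r <= `|u k - v k|) -> r <= `|l - m|.
Proof.
move=> UU ul vm uvr.
apply: (closed_cvg (fun x => r <= x) (@closed_ge R r) uvr).
by apply: cvg_norm; exact: cvgB.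
Qed.

Lemma lim_dist0 (R : realType) (U : set_system nat) (u v : nat -> R)
    (l m : R) (N : nat) : ProperFilter U -> \oo `<=` U ->
  u k @[k --> U] --> l -> v k @[k --> U] --> m ->
  (forall k, (N <= k)%N -> `|u k - v k| <= k.+1%:R^-1) -> l = m.
Proof.
move=> UU ooU ul vm uv; apply/eqP; rewrite -subr_eq0 -normr_le0.
apply/ler_addgt0Pl => e e_gt0; rewrite addr0.
apply: (lim_dist_le UU ul vm); apply: ooU.
exists (maxn N (Num.truncn e^-1)) => // k /=.
rewrite geq_max truncn_le_nat => /andP[/uv kuv ek]; apply: le_trans kuv _.
by rewrite invf_ple ?posrE ?ltr0n // ltW.
Qed.

(* Every point of [D] lies in a sequence of members of the countable family [N]
   such that any choice of points from it clusters in [X]: the network of a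
   Lindelof Sigma space [D] modulo a cover by compact sets. *)
Definition sigma_network (X : topologicalType) (D : set X) (N : nat -> set X) :=
  forall x, D x -> exists s : nat -> nat, (forall k, N (s k) x) /\
    forall U : set_system nat, UltraFilter U -> \oo `<=` U ->
    forall y : nat -> X, (forall k, N (s k) (y k)) ->
    exists z : X, y k @[k --> U] --> z.

Lemma oscillation_dense (R : realType) (X : topologicalType) (D : set X)
    (f g : X -> R) (e : R) :
  dense D -> continuous f -> continuous g ->
  (forall x, D x -> `|f x - g x| <= e) -> forall x, `|f x - g x| <= e.
Proof.
move=> dD fc gc fge x; rewrite leNgt; apply/negP => fgx.
have fg_open : open [set y | e < `|f y - g y|].
  apply: (@open_comp _ _ (fun y => `|f y - g y|) [set r | e < r]) => [y _|].
    by apply: cvg_norm; apply: cvgB; [exact: fc|exact: gc].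
  exact: open_gt.
have [y [/= fgy /fge]] := dD _ (ex_intro _ x fgx) fg_open.
by rewrite leNgt fgy.
Qed.

(** The 2-adic valuation of [n + 1] is a schedule that returns to every task [i] infinitely often;
    [n + 1 = 2 ^ i * (2 * k + 1)] is a stage for it. *)
Lemma exists_stage (i k : nat) :
  exists2 n, (k <= n)%N & logn 2 n.+1 = i.
Proof.
have m_gt0 : (0 < 2 ^ i * k.*2.+1)%N by rewrite muln_gt0 expn_gt0.
exists (2 ^ i * k.*2.+1).-1.
  rewrite -ltnS prednK //; apply: leq_trans (leq_pmull _ _); last first.
    by rewrite expn_gt0.
  by rewrite ltnS -addnn leq_addr.
rewrite prednK // lognM ?expn_gt0 // pfactorK //.
by rewrite (@lognE 2 k.*2.+1) /= dvdn2 /= odd_double addn0.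
Qed.

(* Suppose not, and shrink balls [b n] while recording pairs of points which all
   functions of the new ball separate but the previous centres hardly do: in [X]
   infinitely often, and in each member of the network whenever the oscillation
   of the ball on it is not small.  By the network, a limit [f] of the centres
   along the recorded points is determined up to [e / 9] by its values there.
   But a limit [f'] of the centres cannot separate points which no centre
   separates, whereas [f] does, by the pairs recorded in [X]. *)
Lemma norm_fragmented (R : realType) (T X : topologicalType)
    (Phi : T -> X -> R) (D : set X) (N : nat -> set X)
    (b0 : T * seq X * R) (e : R) :
  pseudocompact_space R T -> pseudocompact_space R X ->
  (forall x, continuous (Phi^~ x)) -> (forall t, continuous (Phi t)) ->
  dense D -> sigma_network D N -> 0 < b0.2 -> 0 < e ->
  exists b : T * seq X * R, [/\ 0 < b.2, pball Phi b `<=` pball Phi b0 &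
    forall t t', pball Phi b t -> pball Phi b t' ->
      forall x, `|Phi t x - Phi t' x| <= e].
Proof.
move=> pcT pcX cT cX dD netN b0_gt0 e_gt0; apply: contrapT => fat.
have PhiM t : exists M : R, forall x, `|Phi t x| <= M.
  exact: pseudocompact_bound pcX (cX t).
(* Task 0 is all of [X] with tolerance [e], task [j + 1] is [N j] with tolerance [e / 9]. At the end
   two errors [e / 9] have to stay below [e / 3]. *)
pose NN i := if i is j.+1 then N j else setT.
pose ee i := if i is _.+1 then e / 9 else e.
have ee_gt0 i : 0 < ee i by case: i => [|i] //=; rewrite divr_gt0.
pose dich (n : nat) (G : seq T) (b : T * seq X * R) :=
  (forall t t', pball Phi b t -> pball Phi b t' ->
    forall x, NN (logn 2 n.+1) x ->
      `|Phi t x - Phi t' x| <= ee (logn 2 n.+1)) \/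
  exists x y, [/\ NN (logn 2 n.+1) x /\ NN (logn 2 n.+1) y,
    x \in b.1.2 /\ y \in b.1.2,
    {in G, forall g, `|Phi g x - Phi g y| < n.+1%:R^-1} &
    forall t, pball Phi b t -> ee (logn 2 n.+1) / 3 <= `|Phi t x - Phi t y|].
have stepP (p : nat * seq T * (T * seq X * R)) : exists b' : T * seq X * R,
    0 < p.2.2 ->
    [/\ 0 < b'.2, pball Phi b' `<=` pball Phi p.2 & dich p.1.1 p.1.2 b'].
  (* A default for radii that are not positive; all radii of the construction are positive. *)
  have [p_gt0|_] := ltP 0 p.2.2; last by exists p.2.
  have [|b' ?] := @pball_step _ _ _ Phi p.2 p.1.2 (NN (logn 2 p.1.1.+1))
    (ee (logn 2 p.1.1.+1)) p.1.1.+1%:R^-1 PhiM p_gt0 (ee_gt0 _).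
    by rewrite invr_gt0.
  by exists b'.
have [step Hstep] := choice stepP.
pose next n (s : seq T * (T * seq X * R)) :=
  (s.2.1.1 :: s.1, step (n, s.2.1.1 :: s.1, s.2)).
pose st := fix st n := if n is m.+1 then next m (st m) else ([::], b0).
pose b n := (st n).2; pose g n := (b n).1.1; pose G n := g n :: (st n).1.
have b_gt0 n : 0 < (b n).2.
  by elim: n => [|n IH] //; have [] := Hstep (n, G n, b n) IH.
have bS n : pball Phi (b n.+1) `<=` pball Phi (b n) /\ dich n (G n) (b n.+1).
  by have [] := Hstep (n, G n, b n) (b_gt0 n).
have b_sub m n : (m <= n)%N -> pball Phi (b n) `<=` pball Phi (b m).
  elim: n => [|n IH]; first by rewrite leqn0 => /eqP->.
  rewrite leq_eqVlt => /predU1P[-> //|/IH]; apply: subset_trans.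
  by have [] := bS n.
have gb m n : (m <= n)%N -> pball Phi (b m) (g n).
  by move=> /b_sub; apply => x _; rewrite subrr normr0 ltW.
have gG j n : (j <= n)%N -> g j \in G n.
  elim: n => [|n IH]; first by rewrite leqn0 => /eqP->; exact: mem_head.
  rewrite leq_eqVlt => /predU1P[->|/IH gn]; first exact: mem_head.
  by rewrite /G inE gn orbT.
have [U [UU ooU]] := @ultraFilterLemma nat \oo _.
(* At all recorded points [f] has the limit values of the centres; hence it lies in every ball. *)
pose limg f := forall n,
  {in (b n).1.2, forall a, Phi (g k) a @[k --> U] --> Phi f a}.
have lim_ball f n : limg f -> pball Phi (b n) f.
  move=> gf a ba; apply: (lim_dist_le _ (gf n a ba) (cvg_cst (Phi (g n) a))).
  by apply: ooU; exists n => // k /= nk; exact: gb nk a ba.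
have limit_exists (s : seq X) : exists2 f, limg f &
    {in s, forall a, Phi (g k) a @[k --> U] --> Phi f a}.
  have [f gf] :=
    pseudocompact_ultralimit g (fun n => s ++ (b n).1.2) pcT cT UU.
  exists f => [n a ba|a sa]; first by apply: (gf n); rewrite mem_cat ba orbT.
  by apply: (gf 0); rewrite mem_cat sa.
have limg_unique f f' x : limg f -> limg f' -> `|Phi f x - Phi f' x| <= e / 9.
  move=> gf gf'; apply: (oscillation_dense dD (cX f) (cX f')) => {}x Dx.
  rewrite leNgt; apply/negP => ff'x; have [s [Ns sU]] := netN x Dx.
  (* Since [f] and [f'] lie in every ball and differ at [x], which is in [N (s k)], a stage for
     [N (s k)] must have recorded a pair. *)
  have sepP k : exists p : X * X, exists n, [/\ N (s k) p.1 /\ N (s k) p.2,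
      p.1 \in (b n).1.2 /\ p.2 \in (b n).1.2,
      forall j, (j <= k)%N -> `|Phi (g j) p.1 - Phi (g j) p.2| <= k.+1%:R^-1 &
      e / 9 / 3 <= `|Phi f p.1 - Phi f p.2|].
    have [n kn lgn] := exists_stage (s k).+1 k.
    have [_] := bS n; rewrite /dich lgn /= => -[thin|[p [q [pq bpq Gpq bf]]]].
      by move: ff'x; rewrite ltNge thin //; exact: lim_ball.
    exists (p, q), n.+1; split=> //=; last exact/bf/lim_ball.
    move=> j jk; apply/ltW/(lt_le_trans (Gpq (g j) _)).
      by apply: gG; exact: leq_trans kn.
    by rewrite lef_pV2 ?posrE ?ltr0n // ler_nat ltnS.
  have [p Hp] := choice sepP.
  have [x' px'] : exists z : X, (p k).1 @[k --> U] --> z.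
    by apply: (sU U UU ooU (fun k => (p k).1)) => k; have [n [[]]] := Hp k.
  have [y' py'] : exists z : X, (p k).2 @[k --> U] --> z.
    by apply: (sU U UU ooU (fun k => (p k).2)) => k; have [n [[]]] := Hp k.
  (* [h] follows the centres at [x'] and [y'] too. It agrees with [f] at the recorded pairs, hence
     at their limits by continuity. *)
  have [h gh gxy] := limit_exists [:: x'; y'].
  have limP t z q : q k @[k --> U] --> z -> Phi t (q k) @[k --> U] --> Phi t z.
    by move=> qz; exact: (continuous_cvg _ (cX t z) qz).
  have hf a n : a \in (b n).1.2 -> Phi h a = Phi f a.
    by move=> ba; exact: (cvg_unique _ (gh n a ba) (gf n a ba)).
  have hx : Phi h x' = Phi f x'.
    apply: (lim_dist0 (N := 0) _ ooU (limP h _ _ px') (limP f _ _ px')) => k _.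
    by have [n [_ [bp _] _ _]] := Hp k; rewrite (hf _ n) // subrr normr0.
  have hy : Phi h y' = Phi f y'.
    apply: (lim_dist0 (N := 0) _ ooU (limP h _ _ py') (limP f _ _ py')) => k _.
    by have [n [_ [_ bp] _ _]] := Hp k; rewrite (hf _ n) // subrr normr0.
  have gxy' j : Phi (g j) x' = Phi (g j) y'.
    apply: (lim_dist0 (N := j) _ ooU (limP _ _ _ px') (limP _ _ _ py')) => k jk.
    by have [n [_ _ + _]] := Hp k; apply.
  have fxy : Phi f x' = Phi f y'.
    rewrite -hx -hy; apply: (cvg_unique _ (gxy x' (mem_head _ _))) => //.
    rewrite /= (_ : (fun k => _) = (fun k => Phi (g k) y')).
      by apply: gxy; rewrite !inE eqxx orbT.
    by apply/funext => k; exact: gxy'.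
  have : e / 9 / 3 <= `|Phi f x' - Phi f y'|.
    apply: (lim_dist_ge _ (limP f _ _ px') (limP f _ _ py')); apply: nearW => k.
    by have [n []] := Hp k.
  by rewrite fxy subrr normr0 leNgt divr_gt0 // divr_gt0.
have sepP k : exists p : X * X,
    (forall j, (j <= k)%N -> `|Phi (g j) p.1 - Phi (g j) p.2| <= k.+1%:R^-1) /\
    forall f, limg f -> e / 3 <= `|Phi f p.1 - Phi f p.2|.
  have [n kn lgn] := exists_stage 0 k.
  have [_] := bS n; rewrite /dich lgn /= => -[thin|[p [q [_ _ Gpq bf]]]].
    case: fat; exists (b n.+1); split; [exact: b_gt0|exact: (b_sub 0)|].
    by move=> t t' bt bt' x; exact: thin.
  exists (p, q); split=> [j jk|f gf] /=; last exact/bf/lim_ball.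
  apply/ltW/(lt_le_trans (Gpq (g j) _)).
    by apply: gG; exact: leq_trans kn.
  by rewrite lef_pV2 ?posrE ?ltr0n // ler_nat ltnS.
have [p Hp] := choice sepP.
have [f gf _] := limit_exists [::].
(* [x] and [y] act as limits of the pairs only for [f] and all the centres. *)
have [x px] := pseudocompact_ultralimit (Phi := fun x t => Phi t x)
  (fun k => (p k).1) (fun n => [:: f; g n]) pcX cX UU.
have [y py] := pseudocompact_ultralimit (Phi := fun x t => Phi t x)
  (fun k => (p k).2) (fun n => [:: f; g n]) pcX cX UU.
have gxy j : Phi (g j) x = Phi (g j) y.
  have gj : g j \in [:: f; g j] by rewrite !inE eqxx orbT.
  apply: (lim_dist0 (N := j) _ ooU (px j _ gj) (py j _ gj)) => k jk.
  by have [+ _] := Hp k; apply.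
(* [f'] cannot separate [x] from [y], yet it is within [e / 9] of [f] at both. *)
have [f' gf' f'xy] := limit_exists [:: x; y].
have f'E : Phi f' x = Phi f' y.
  apply: (cvg_unique _ (f'xy x (mem_head _ _))) => //.
  rewrite /= (_ : (fun k => _) = (fun k => Phi (g k) y)).
    by apply: f'xy; rewrite !inE eqxx orbT.
  by apply/funext => k; exact: gxy.
have : e / 3 <= `|Phi f x - Phi f y|.
  apply: (lim_dist_ge _ (px 0 f (mem_head _ _)) (py 0 f (mem_head _ _))).
  by apply: nearW => k; exact: (Hp k).2.
have := limg_unique f f' x gf gf'; have := limg_unique f' f y gf' gf.
have := ler_distD (Phi f' x) (Phi f x) (Phi f y); rewrite f'E; lra.
Qed.

(** * Continuity of pointwise limits *)

Lemma near_forall_seq (X : Type) (I : eqType) (s : seq I)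
    (F : set_system X) (P : I -> X -> Prop) : Filter F ->
  (forall i, \forall x \near F, P i x) ->
  \forall x \near F, {in s, forall i, P i x}.
Proof.
move=> FF FP; elim: s => [|i s IH]; first exact: nearW.
near=> x => j; rewrite inE => /orP[/eqP->|]; first by near: x; exact: FP.
by move: j; near: x.
Unshelve. all: by end_near. Qed.

(* A double sequence argument in the style of Grothendieck; the balls [b n]
   replace functions because [T] is only pseudocompact, and the limit point [t]
   of the balls shares the limits of their centres thanks to thinness. *)
Lemma pointwise_limit_continuous (R : realType) (T X : topologicalType)
    (Phi : T -> X -> R) (D : set X) (N : nat -> set X) (h : X -> R) :
  pseudocompact_space R T -> pseudocompact_space R X ->
  (forall x, continuous (Phi^~ x)) -> (forall t, continuous (Phi t)) ->
  dense D -> sigma_network D N ->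
  (forall (s : seq X) (e : R), 0 < e ->
    exists t, {in s, forall x, `|Phi t x - h x| <= e}) ->
  continuous h.
Proof.
move=> pcT pcX cT cX dD netN hPhi x0; apply/cvgrPdist_lt => e e_gt0.
apply: contrapT => hx0.
have far V : nbhs x0 V -> exists2 x, V x & e <= `|h x0 - h x|.
  move=> x0V; apply: contrapT => Ve; apply: hx0; apply: filterS x0V => x Vx.
  by rewrite ltNge; apply/negP => hx; apply: Ve; exists x.
(* Given earlier points and centres, choose a thin ball whose members are close to [h] at these
   points, then a point where [h] is far from [h x0] although the old and new centres hardly change
   from [x0]. *)
have stepP (p : nat * seq X * seq T) : exists q : (T * seq X * R) * X,
    [/\ 0 < q.1.2,
      forall t, pball Phi q.1 t ->
        {in p.1.2, forall a, `|Phi t a - h a| <= p.1.1.+1%:R^-1 *+ 2},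
      forall t t', pball Phi q.1 t -> pball Phi q.1 t' ->
        forall x, `|Phi t x - Phi t' x| <= p.1.1.+1%:R^-1,
      e <= `|h x0 - h q.2| &
      {in q.1.1.1 :: p.2, forall g, `|Phi g q.2 - Phi g x0| <= p.1.1.+1%:R^-1}].
  case: p => [[n s] gs] /=.
  have n_gt0 : 0 < n.+1%:R^-1 :> R by rewrite invr_gt0.
  have [t ht] := hPhi s _ n_gt0.
  have [//|b [b_gt0 bt thin]] := norm_fragmented (b0 := (t, s, n.+1%:R^-1))
    pcT pcX cT cX dD netN _ n_gt0.
  have gn : \forall x \near x0,
      {in b.1.1 :: gs, forall g, `|Phi g x - Phi g x0| <= n.+1%:R^-1}.
    apply: near_forall_seq => g; have := cX g x0.
    move=> /cvgr_dist_le /(_ _ n_gt0); apply: filterS => x.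
    by rewrite distrC.
  have [x xg hx] := far _ gn; exists (b, x); split=> // u /bt ut a sa.
  rewrite mulr2n; apply: le_trans (ler_distD (Phi t a) _ _) _.
  by apply: lerD; [exact: ut|exact: ht].
have [step Hstep] := choice stepP.
pose next n (s : seq X * seq T) :=
  let q := step (n, s.1, s.2) in (q.2 :: s.1, q.1.1.1 :: s.2).
pose st := fix st n := if n is m.+1 then next m (st m) else ([:: x0], [::]).
pose q n := step (n, (st n).1, (st n).2).
pose b n := (q n).1; pose x n := (q n).2; pose g n := (b n).1.1.
have Hq n := Hstep (n, (st n).1, (st n).2).
have x0_st n : x0 \in (st n).1.
  by elim: n => [|n IH]; rewrite /= inE ?eqxx // IH orbT.
have x_st j n : (j < n)%N -> x j \in (st n).1.
  elim: n => // n IH; rewrite ltnS leq_eqVlt => /predU1P[->|/IH xn] /=.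
    exact: mem_head.
  by rewrite inE xn orbT.
have g_st j n : (j <= n)%N -> g j \in (st n.+1).2.
  elim: n => [|n IH]; first by rewrite leqn0 => /eqP->; exact: mem_head.
  rewrite leq_eqVlt => /predU1P[->|/IH gn]; first exact: mem_head.
  by rewrite [(st n.+2).2]/= inE; apply/orP; right.
(* Continuous, positive at the centre, and positive only inside the ball [b n]. *)
pose u n t := (b n).2 - \sum_(a <- (b n).1.2) `|Phi t a - Phi (g n) a|.
have u_cont n : continuous (u n).
  move=> t; apply: cvgB; first exact: cvg_cst.
  apply: (@continuous_sum_seq _ _ _ _ (fun a t => `|Phi t a - Phi (g n) a|)).
  move=> a s; apply: cvg_norm; apply: cvgB; [exact: cT|exact: cvg_cst].
have u_gt0 n : 0 < u n (g n).
  rewrite /u big1 ?subr0; first by have [] := Hq n.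
  by move=> a _; rewrite subrr normr0.
have u_ball n t : 0 < u n t -> pball Phi (b n) t.
  rewrite subr_gt0 => /ltW bt a ba; apply: le_trans bt.
  by rewrite (big_rem _ ba) /= lerDl sumr_ge0.
have [t Ht] := pseudocompact_accumulation pcT u_cont u_gt0.
have acc a a' r M : 0 < r -> exists n s,
    [/\ (M <= n)%N, n.+1%:R^-1 <= r, pball Phi (b n) s,
      `|Phi t a - Phi s a| < r & `|Phi t a' - Phi s a'| < r].
  move=> r_gt0.
  have ta : \forall s \near t, `|Phi t a - Phi s a| < r.
    by have := cT a t; move=> /cvgr_dist_lt; apply.
  have ta' : \forall s \near t, `|Phi t a' - Phi s a'| < r.
    by have := cT a' t; move=> /cvgr_dist_lt; apply.
  have [n [Mn [s [as_ as'] us]]] :=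
    Ht _ (filterI ta ta') (maxn M (Num.truncn r^-1)).
  move: Mn; rewrite geq_max truncn_le_nat => /andP[Mn rn].
  exists n, s; split=> //; last exact: u_ball.
  by rewrite invf_ple ?posrE ?ltr0n // ltW.
(* Near [t] there are members of late balls, and these approximate [h] at [a]. *)
have th a M : (forall n, (M <= n)%N -> a \in (st n).1) -> Phi t a = h a.
  move=> ast; apply/eqP; rewrite -subr_eq0 -normr_le0.
  apply/ler_addgt0Pl => r r_gt0; rewrite addr0.
  have r3_gt0 : 0 < r / 3 by rewrite divr_gt0.
  have [n [s [Mn nr bs ts _]]] := acc a a (r / 3) M r3_gt0.
  have [_ hq _ _ _] := Hq n; have := hq s bs a (ast n Mn); rewrite /= mulr2n.
  move=> /le_trans /(_ (lerD nr nr)).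
  have := ler_distD (Phi s a) (Phi t a) (h a).
  by move: ts; lra.
have tx0 : Phi t x0 = h x0 by apply: (th _ 0).
have tx j : Phi t (x j) = h (x j) by apply: (th _ j.+1) => n; exact: x_st.
have [U [UU ooU]] := @ultraFilterLemma nat \oo _.
(* Seen from the centres [y] looks like [x0], whereas [t], which equals [h] at each [x j], separates
   the two by at least [e]. *)
have [y xy] := pseudocompact_ultralimit (Phi := fun x t => Phi t x)
  x (fun n => [:: t; g n]) pcX cX UU.
have gy j : Phi (g j) y = Phi (g j) x0.
  have gj : g j \in [:: t; g j] by rewrite !inE eqxx orbT.
  apply: (lim_dist0 (N := j) _ ooU (xy j _ gj) (cvg_cst _)) => k jk.
  have [_ _ _ _ gk] := Hq k; apply: gk; exact: g_st.
have ty : e <= `|h x0 - Phi t y|.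
  apply: (lim_dist_ge _ (cvg_cst (h x0)) (xy 0 t (mem_head _ _))).
  by apply: nearW => k; rewrite tx; have [] := Hq k.
have e5_gt0 : 0 < e / 5 by rewrite divr_gt0.
(* The way from [Phi t x0] to [Phi t y] through [s] and [g n], which agrees at [x0] and [y], costs
   four errors of at most [e / 5]. *)
have [n [s [_ ne bs tsx tsy]]] := acc x0 y (e / 5) 0 e5_gt0.
have [_ _ thin _ _] := Hq n.
have gb : pball Phi (b n) (g n).
  by move=> a _; rewrite subrr normr0 ltW //; have [] := Hq n.
have sx0 := le_trans (thin _ _ bs gb x0) ne.
have sy := le_trans (thin _ _ bs gb y) ne.
have := ler_distD (Phi s x0) (Phi t x0) (Phi t y).
have := ler_distD (Phi (g n) y) (Phi s x0) (Phi t y).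
have := ler_distD (Phi s y) (Phi (g n) y) (Phi t y).
rewrite (distrC (Phi (g n) y) (Phi s y)) (distrC (Phi s y) (Phi t y)).
by move: ty tsx tsy sx0 sy; rewrite tx0 -gy; lra.
Qed.

(** * Networks of Lindelof Sigma spaces *)

Lemma cvg_to_initial (S : choiceType) (T : topologicalType) (f : S -> T)
    (F : set_system S) (s : S) : Filter F ->
  f x @[x --> F] --> f s -> F --> (s : initial_topology f).
Proof.
move=> FF ffs A [_ [[B Bop <-] Bfs] BA].
by rewrite nbhs_filterE; apply: filterS BA _; apply: ffs; exact: open_nbhs_nbhs.
Qed.

(** With [D] the image under [p] of a closed subset [F] of [K * M], the network consists of the
    images of the parts of [F] over balls around a countable dense subset of [M]. Points chosen over
    balls shrinking to [m] lift to [F]: their second coordinates tend to [m], their first ones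
    converge along [U] by compactness, and the limit lies in [F]. *)
Lemma lindelof_sigma_network (R : realType) (X : topologicalType) (D : set X) :
  lindelof_sigma_space R (set_type D) -> exists N, sigma_network D N.
Proof.
move=> [_ [L [[K [M [F [[_ cptK] [[A cntA dA] [M' [phi [psi]]]]]]]]]]].
move=> [phic psic phiK psiK] Fcl [i [j [_ jc ij _]]] [f [fc fD]].
have [code codeI] := countable_injP _ cntA.
pose p z : X := set_val (f (j z)).
have pc : continuous p.
  move=> z.
  apply: (continuous_comp (f := j) (g := fun l => set_val (f l)) (jc z)).
  apply: (continuous_comp (f := f) (g := @set_val _ D) (fc (j z))).
  exact: (@initial_continuous _ _ (@set_val _ D)).
pose N (c : nat * nat) : set X := p @` [set z : set_type F | exists2 d,
  A d /\ code d = c.1 & ball (phi d) c.2.+1%:R^-1 (phi (set_val z).2)].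
exists (fun n => if unpickle n is Some c then N c else setT) => x Dx.
have [z pz] : exists z, p z = x.
  have [l _ fl] : (f @` setT) (SigSub (mem_set Dx)) by rewrite fD.
  by exists (i l); rewrite /p ij fl set_valE.
pose m := (set_val z).2.
have near_d n : exists d, A d /\ ball (phi d) n.+1%:R^-1 (phi m).
  have n_gt0 : 0 < n.+1%:R^-1 :> R by rewrite invr_gt0.
  have : nbhs m (phi @^-1` ball (phi m) n.+1%:R^-1).
    by apply: (phic m); exact: nbhsx_ballx.
  rewrite nbhsE => -[V [Vop Vm] Vsub].
  have [d [/Vsub Vd Ad]] := dA V (ex_intro _ m Vm) Vop.
  by exists d; split=> //; exact: ball_sym.
have [d Hd] := choice near_d.
exists (fun n => pickle (code (d n), n)); split=> [n|U UU ooU y Ny].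
  rewrite pickleK; exists z => //; exists (d n).
    by split=> //; case: (Hd n).
  by case: (Hd n).
(* The ball has centre [d k], and both [m] and the lifted point are within [1 / (k + 1)] of it. *)
have wP k : exists w : set_type F, p w = y k /\
    ball (phi m) (2 * k.+1%:R^-1) (phi (set_val w).2).
  have := Ny k; rewrite pickleK => -[w [d' [Ad' /= codeE] wd' pw]].
  have [Adk dk] := Hd k.
  have d'E : d' = d k by apply: codeI => //; rewrite inE.
  exists w; split=> //; rewrite mulr2n mulrDl mul1r.
  by apply: ball_triangle (ball_sym dk) _; rewrite -d'E.
have [w Hw] := choice wP.
have cvg_m : (set_val (w k)).2 @[k --> U] --> m.
  have phi_m : phi (set_val (w k)).2 @[k --> U] --> phi m.
    apply/cvg_ballP => e e_gt0; apply: ooU.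
    exists (Num.truncn (2 / e)) => // k /=; rewrite truncn_le_nat => ek.
    have [_] := Hw k; apply: le_ball.
    by rewrite ler_pdivrMr // mulrC -ler_pdivrMr // ltW.
  have := continuous_cvg _ (psic (phi m)) phi_m; rewrite phiK => psi_m.
  have -> : (fun k => (set_val (w k)).2) =
      psi \o (fun k => phi (set_val (w k)).2).
    by apply/funext => k /=; rewrite phiK.
  exact: psi_m.
have [k0 cvg_k0] : exists k0 : K, (set_val (w k)).1 @[k --> U] --> k0.
  have := cptK; rewrite compact_ultra.
  have UwK := ultrafilter_map (fun k => (set_val (w k)).1) UU.
  by move=> /(_ _ UwK filterT)[k0 [_ ?]]; exists k0.
have cvg_w : set_val (w k) @[k --> U] --> (k0, m).
  have -> : (fun k => set_val (w k)) =
      (fun k => ((set_val (w k)).1, (set_val (w k)).2)).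
    by apply/funext => k; case: (set_val (w k)).
  exact: cvg_pair.
have Fw : F (k0, m).
  apply: (closed_cvg F Fcl _ _ cvg_w); apply: nearW => k; exact: set_valP.
exists (p (SigSub (mem_set Fw))).
have -> : y = p \o w by apply/funext => k; have [] := Hw k.
apply: (continuous_cvg _ (pc _)); apply: cvg_to_initial.
by rewrite set_valE.
Qed.

(** * Pointwise convergence in [Cp] and compactness of closures *)

Lemma Cp_eval_continuous (R : realType) (X : topologicalType) (x : X) :
  continuous (fun f : Cp R X => f x).
Proof.
move=> f; apply: (continuous_comp (f := fun f : Cp R X => (f : {ptws X -> R}))
  (g := fun g => g x)).
  exact: (@initial_continuous (continuousType X R) {ptws X -> R}).
exact: (@proj_continuous X (fun=> R)).
Qed.

Lemma cvg_Cp (R : realType) (X : topologicalType) (G : set_system (Cp R X))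
    (h : Cp R X) : Filter G ->
  (forall x, (f : Cp R X) x @[f --> G] --> h x) -> G --> h.
Proof.
move=> FG Gh.
apply: (@cvg_to_initial (continuousType X R) {ptws X -> R} (fun f => f)).
exact/pointwise_cvgP.
Qed.

Theorem theorem7 (R : realType) (X : topologicalType)
    (X_tychonoff : tychonoff_space X)
    (X_pseudocompact : pseudocompact_space R X)
    (X_dense_sigma : exists D : set X,
       dense D /\ lindelof_sigma_space R (set_type D)) :
  mu_sharp_pc_pseudocompact R X.
Proof.
split=> // Y [P [YP pcP]].
have [D [dD /lindelof_sigma_network[N netN]]] := X_dense_sigma.
pose Phi (t : set_type P) (x : X) : R := (set_val t : Cp R X) x.
have cX t : continuous (Phi t) by exact: cts_fun.
have cT x : continuous (Phi^~ x).
  move=> t.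
  apply: (continuous_comp (f := @set_val _ P) (g := fun f : Cp R X => f x)).
    exact: (@initial_continuous _ _ (@set_val _ P)).
  exact: Cp_eval_continuous.
rewrite compact_ultra => G UG GY.
(* On finite sets of points, members of [closure Y] are approximated by members of [P]. *)
have near_Phi (f : Cp R X) (s : seq X) (r : R) : 0 < r -> closure Y f ->
    exists t, {in s, forall x, `|f x - Phi t x| < r}.
  move=> r_gt0 /(_ [set g : Cp R X | {in s, forall x, `|f x - g x| < r}]).
  have near_f : \forall g \near f,
      {in s, forall x, `|f x - (g : Cp R X) x| < r}.
    apply: (@near_forall_seq (Cp R X) X s (nbhs f)
      (fun x g => `|f x - g x| < r)) => x.
    have := @Cp_eval_continuous R X x f.
    by move=> /cvgr_dist_lt /(_ _ r_gt0).
  move=> /(_ near_f)[g [Yg fg]]; exists (SigSub (mem_set (YP g Yg))) => x /fg.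
  by rewrite /Phi set_valE.
(* The bound [M] holds on [P]; passing to [closure Y] costs at most 1. *)
have lim_G x : exists c : R, (f : Cp R X) x @[f --> G] --> c.
  have [M PhiM] := pseudocompact_bound pcP (cT x).
  apply: (@bounded_ultra_cvg R (Cp R X) G (fun f => f x) (M + 1)).
  apply: filterS GY => f Yf /=.
  have [t ft] := near_Phi f [:: x] 1 ltr01 Yf.
  have := ft x (mem_head _ _); have := PhiM t.
  by have := ler_normD (f x - Phi t x) (Phi t x); rewrite subrK; lra.
have [h Hh] := choice lim_G.
have h_cont : continuous h.
  apply: (pointwise_limit_continuous pcP X_pseudocompact cT cX dD netN).
  move=> s r r_gt0; have r2_gt0 : 0 < r / 2 by rewrite divr_gt0.
  have near_h : \forall f \near G,
      {in s, forall x, `|h x - (f : Cp R X) x| < r / 2}.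
    apply: (@near_forall_seq (Cp R X) X s G (fun x f => `|h x - f x| < r / 2)).
    by move=> x; have /cvgr_dist_lt := Hh x; apply.
  have [f [hf Yf]] := filter_ex (filterI near_h GY).
  have [t ft] := near_Phi f s _ r2_gt0 Yf; exists t => x sx.
  have /= hfx := hf x sx; have /= ftx := ft x sx.
  have := ler_distD (f x) (Phi t x) (h x).
  rewrite (distrC (Phi t x) (f x)) (distrC (f x) (h x)) => /le_trans; apply.
  by rewrite (splitr r) lerD // ltW.
pose hC : Cp R X := mkcts h_cont.
have GhC : G --> hC by apply: cvg_Cp => x; exact: Hh.
exists hC; split=> //.
exact: (closed_cvg (closure Y) (@closed_closure _ Y) GY hC GhC).
Qed.
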